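(* Let $H$ be a finite-dimensional Hilbert space, $A: H \to H$ a linear operator with $A = A^* \ge \delta I$ for some $\delta > 0$, $\alpha \in (0,1)$, $\beta = 1-\alpha$, $m \ge 1$, and let $a_i(\beta) > 0$, $b_i(\beta) > 0$, $i = 1,\dots,m$, be real coefficients. Set $$D_i = a_i(\beta)\,(b_i(\beta) I + A)^{-1} A, \quad i = 1,\dots,m, \qquad D = \sum_{i=1}^m D_i,$$ so that $D_i = D_i^* > 0$ and $D_i D_j = D_j D_i$ for $i,j = 1,\dots,m$. Let $u^0 \in H$, $T>0$, $N \ge 1$, $\tau = T/N$, and consider the additive operator-difference (splitting) scheme $$\frac{w^{n+i/m} - w^{n+(i-1)/m}}{\tau} + D_i\big(\sigma w^{n+i/m} + (1-\sigma) w^{n+(i-1)/m}\big) = 0, \quad i = 1,\dots,m, \quad n = 0,\dots,N-1,$$ $$w^0 = u^0 .$$ If $\sigma \ge 0.5$, then this scheme is unconditionally stable (i.e. stable with no restriction on the time step $\tau > 0$), and its solution satisfies the a priori estimate $$\|w^{n+1}\| \le \|u^0\|, \quad n = 0,\dots,N-1 .$$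
   Context: $I$ is the identity operator in $H$, and $\|u\| = (u,u)^{1/2}$ is the norm of $H$. For self-adjoint operators, $P \ge Q$ means $(Pu,u) \ge (Qu,u)$ for all $u \in H$, and $P > 0$ means $(Pu,u) > 0$ for all $u \neq 0$. The operator $D = R_m(A;\beta)A$ comes from a rational approximation $A^{-\beta} \approx R_m(A;\beta) = \sum_{i=1}^m a_i(\beta)(b_i(\beta) I + A)^{-1}$, so that $D$ approximates $A^\alpha$ in the Cauchy problem $\frac{du}{dt} + A^\alpha u = 0$, $u(0) = u^0$; no accuracy property of this approximation is assumed here. The elements $w^{n+i/m} \in H$, $i=1,\dots,m$, are the intermediate approximations on the time step from $t^n = n\tau$ to $t^{n+1} = (n+1)\tau$, with $w^{n+m/m} = w^{n+1}$. *)

(* Defs.v *)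
From mathcomp Require Import all_boot all_order all_algebra.
From mathcomp Require Import reals complex.

Set Implicit Arguments.
Unset Strict Implicit.
Unset Printing Implicit Defensive.

Import Order.TTheory GRing.Theory Num.Theory.
Local Open Scope ring_scope.

(* A Hilbert space is taken over either the real or the complex numbers; the
   parameters of the problem are real and enter through [real_scalar]. *)
Variant scalars := RealScalars | ComplexScalars.

Definition scalar_field (R : realType) (s : scalars) : numFieldType :=
  match s with
  | RealScalars => R : numFieldType
  | ComplexScalars => R[i] : numFieldType
  end.

Definition conj_scalar (R : realType) (s : scalars) :
    involutive_rmorphism (scalar_field R s) :=
  match s with
  | RealScalars => idfun : involutive_rmorphism R
  | ComplexScalars => Num.conj : involutive_rmorphism R[i]
  end.

Definition real_scalar (R : realType) (s : scalars) :
    R -> scalar_field R s :=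
  match s with
  | RealScalars => fun x => x
  | ComplexScalars => fun x => (x%:C)%C
  end.

Definition re_scalar (R : realType) (s : scalars) :
    scalar_field R s -> R :=
  match s with
  | RealScalars => fun x => x
  | ComplexScalars => fun z => complex.Re z
  end.

Notation "x %:K" := (real_scalar _ x)
  (at level 2, left associativity, format "x %:K") : ring_scope.

Section HilbertSpace.
Context (R : realType) (s : scalars).
Context (H : vectType (scalar_field R s)) (dot : {dot H for conj_scalar R s}).
Implicit Types P Q : 'End(H).

(* The real part only changes the type: [dot u u] is a nonnegative real. *)
Definition hnorm (u : H) : R := Num.sqrt (re_scalar (dot u u)).

Definition self_adjoint P := forall u v : H, dot (P u) v = dot u (P v).

(* In the complex case [x <= y] on scalars means that [y - x] is a nonnegative
   real, so these are the usual relations between quadratic forms. *)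
Definition op_ge P Q := forall u : H, dot (Q u) u <= dot (P u) u.

Definition op_pos P := forall u : H, u != 0 -> 0 < dot (P u) u.

End HilbertSpace.

Section SplittingScheme.
Context (R : realType) (s : scalars) (H : vectType (scalar_field R s)).
Context (dot : {dot H for conj_scalar R s}).
Context (m : nat) (D : 'I_m -> 'End(H)) (sigma : R).

(* [w k] stands for w^{k/m}: the intermediate value w^{n+i/m} is
   [w (n * m + i)], and in particular w^n is [w (n * m)].  The operator D_i of
   the i-th substep, 1 <= i <= m, is [D] at the ordinal i - 1. *)
Definition solves_scheme (tau : R) (N : nat) (u0 : H) (w : nat -> H) : Prop :=
  w 0%N = u0 /\
  forall (n : nat) (i : 'I_m), (n < N)%N ->
    (tau^-1)%:K *: (w (n * m + i.+1)%N - w (n * m + i)%N)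
    + D i (sigma%:K *: w (n * m + i.+1)%N + (1 - sigma)%:K *: w (n * m + i)%N)
    = 0.

(* Uniqueness concerns only the levels k/m <= N that the scheme determines. *)
Definition uniquely_solvable (tau : R) (N : nat) (u0 : H) : Prop :=
  (exists w, solves_scheme tau N u0 w) /\
  (forall w v, solves_scheme tau N u0 w -> solves_scheme tau N u0 v ->
     forall k : nat, (k <= N * m)%N -> w k = v k).

(* Continuous dependence of the solution on the initial data, with a constant
   that does not depend on the step, which is an arbitrary tau > 0. *)
Definition unconditionally_stable : Prop :=
  exists2 M : R, 0 < M &
    forall (tau : R) (N : nat) (u0 v0 : H) (w v : nat -> H),
      0 < tau -> (0 < N)%N ->
      solves_scheme tau N u0 w -> solves_scheme tau N v0 v ->
      forall n : nat, (n <= N)%N ->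
        hnorm dot (w (n * m)%N - v (n * m)%N) <= M * hnorm dot (u0 - v0).

End SplittingScheme.

(* Main.v *)
(* Every D_i is self-adjoint and positive: on a vector (b_i I + A) p it takes
   the value a_i A p, and both properties become identities between quadratic
   forms in p.  Pairing a substep of the scheme with its weighted average
   sigma w^{n+i/m} + (1 - sigma) w^{n+(i-1)/m} then shows that the substep does
   not increase the norm.  Stability and uniqueness follow by applying this to
   the difference of two solutions. *)
Require Import Defs.
From HB Require Import structures.
From mathcomp Require Import all_boot all_order all_algebra.
From mathcomp Require Import reals complex.
From mathcomp Require Import ring.

Set Implicit Arguments.
Unset Strict Implicit.
Unset Printing Implicit Defensive.

Import Order.TTheory GRing.Theory Num.Theory.
Local Open Scope ring_scope.

(** * Real parameters inside the real or complex scalar field *)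

Section ScalarEmbedding.
Context (R : realType) (s : scalars).
Local Notation K := (scalar_field R s).

Lemma real_scalar_is_zmod_morphism : zmod_morphism (@real_scalar R s).
Proof. by case: s => //= x y; rewrite rmorphB. Qed.

Lemma real_scalar_is_monoid_morphism : monoid_morphism (@real_scalar R s).
Proof. by case: s; split=> //= x y; rewrite rmorphM. Qed.

HB.instance Definition _ :=
  GRing.isZmodMorphism.Build R K (@real_scalar R s) real_scalar_is_zmod_morphism.
HB.instance Definition _ :=
  GRing.isMonoidMorphism.Build R K (@real_scalar R s)
    real_scalar_is_monoid_morphism.

(** This lets real coefficients leave the conjugate-linear second argument of [dot] unchanged. *)
Lemma conj_real_scalar (x : R) : conj_scalar R s (x%:K) = x%:K.
Proof. by case: s => //=; exact: conjc_real. Qed.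

Lemma real_scalar_le : {mono @real_scalar R s : x y / x <= y}.
Proof. by case: s => //= x y; rewrite lecR. Qed.

Lemma real_scalar_lt : {mono @real_scalar R s : x y / x < y}.
Proof. by case: s => //= x y; rewrite ltcR. Qed.

Lemma re_scalar_le (x y : K) : x <= y -> re_scalar x <= re_scalar y.
Proof. by case: s x y => //= x y; rewrite lecE => /andP[]. Qed.

Lemma real_scalar_ge0 (x : R) : 0 <= x -> 0 <= x%:K :> K.
Proof.
by rewrite -[0 in X in _ -> X](rmorph0 (@real_scalar R s)) real_scalar_le.
Qed.

Lemma real_scalar_gt0 (x : R) : 0 < x -> 0 < x%:K :> K.
Proof.
by rewrite -[0 in X in _ -> X](rmorph0 (@real_scalar R s)) real_scalar_lt.
Qed.

End ScalarEmbedding.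

(** * Positive operators and their inverses *)

Section PositiveOperators.
Context (R : realType) (s : scalars) (H : vectType (scalar_field R s)).
Context (dot : {dot H for conj_scalar R s}).
Implicit Types (u v : H) (P Q : 'End(H)) (c : R).

Lemma dotDl u v w : dot (u + v) w = dot u w + dot v w.
Proof. exact: linearDl. Qed.
Lemma dotDr u v w : dot w (u + v) = dot w u + dot w v.
Proof. exact: linearDr. Qed.
Lemma dotNl u v : dot (- u) v = - dot u v.
Proof. exact: linearNl. Qed.
Lemma dotNr u v : dot v (- u) = - dot v u.
Proof. exact: linearNr. Qed.
Lemma dot_realZl c u v : dot (c%:K *: u) v = c%:K * dot u v.
Proof. exact: linearZl_LR. Qed.
Lemma dot_realZr c u v : dot u (c%:K *: v) = c%:K * dot u v.
Proof. by rewrite linearZr_LR /= conj_real_scalar. Qed.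

Lemma dot_self_gt0 u : u != 0 -> 0 < dot u u.
Proof. exact: neq0_dnorm_gt0. Qed.
Lemma dot_self_ge0 u : 0 <= dot u u.
Proof.
by have [->|/dot_self_gt0/ltW//] := eqVneq u 0; rewrite linear0r.
Qed.

Lemma op_pos_ge0 P u : op_pos dot P -> 0 <= dot (P u) u.
Proof.
by have [->|u0 /(_ u u0)/ltW//] := eqVneq u 0; rewrite linear0r.
Qed.

(** If [P u = 0] then [dot (P u) u = 0], which positivity forbids for [u != 0]. In finite dimension
    this makes [P^-1] a two-sided inverse. *)
Lemma op_pos_lker0 P : op_pos dot P -> lker P == 0%VS.
Proof.
move=> P_pos; rewrite -subv0; apply/subvP => u.
rewrite memv_ker memv0 => /eqP Pu0; apply/negPn/negP => /P_pos.
by rewrite Pu0 linear0l ltxx.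
Qed.

(** Serves twice: for b I + A ([c' = 1]), and for the operator I / tau + sigma D_i of an implicit
    substep. *)
Lemma op_pos_shift P c c' : 0 < c -> 0 <= c' -> op_pos dot P ->
  op_pos dot (c%:K *: \1 + c'%:K *: P)%VF.
Proof.
move=> c0 c'0 P_pos u u0.
rewrite !lfunE /= !lfunE /= !lfunE /= dotDl !dot_realZl ltr_pwDl //.
  by rewrite mulr_gt0 ?real_scalar_gt0 ?dot_self_gt0.
by rewrite mulr_ge0 ?real_scalar_ge0 // op_pos_ge0.
Qed.

Lemma op_ge_pos P c :
  0 < c -> op_ge dot P (c%:K *: \1%VF) -> op_pos dot P.
Proof.
move=> c0 P_ge u u0; apply: lt_le_trans (P_ge u).
rewrite !lfunE /= !lfunE /= dot_realZl.
by rewrite mulr_gt0 ?real_scalar_gt0 ?dot_self_gt0.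
Qed.

(** Q P^-1 = P^-1 P Q P^-1 = P^-1 Q P P^-1 = P^-1 Q. *)
Lemma comp_inv_lfun_comm P Q : lker P == 0%VS ->
  (P \o Q = Q \o P)%VF -> (P^-1 \o Q = Q \o P^-1)%VF.
Proof.
move=> P0 PQ; rewrite -[RHS](lker0_compKf P0) [(P \o (Q \o _))%VF]comp_lfunA PQ.
by rewrite lker0_compfK.
Qed.

End PositiveOperators.

(** * The operators a (b I + A)^-1 A *)

Section RationalFactor.
Context (R : realType) (s : scalars) (H : vectType (scalar_field R s)).
Context (dot : {dot H for conj_scalar R s}) (A : 'End(H)).
Hypotheses (A_sa : self_adjoint dot A) (A_pos : op_pos dot A).
Implicit Types a b : R.

Local Notation shift b := (b%:K *: \1 + A)%VF.

Definition rational_factor a b : 'End(H) :=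
  (a%:K *: ((shift b)^-1 \o A))%VF.

Lemma lker0_shift b : 0 < b -> lker (shift b) == 0%VS.
Proof.
move=> b0; apply: (@op_pos_lker0 _ _ _ dot); rewrite -[A]scale1r.
by rewrite -(rmorph1 (@real_scalar R s)); apply: op_pos_shift.
Qed.

Lemma shiftE b u : shift b u = b%:K *: u + A u.
Proof. by rewrite !lfunE /= !lfunE /= lfunE. Qed.

Lemma shift_comm b : (shift b \o A = A \o shift b)%VF.
Proof.
by apply/lfunP => u; rewrite !lfunE /= !shiftE linearD linearZ.
Qed.

Lemma shift_comm_shift b b' : (shift b \o shift b' = shift b' \o shift b)%VF.
Proof.
apply/lfunP => u; rewrite !comp_lfunE [LHS](shiftE b) -[A _]comp_lfunE.
by rewrite -shift_comm comp_lfunE -linearZ -linearD -shiftE.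
Qed.

(** A commutes with b I + A, so the shift meets its inverse and cancels. *)
Lemma rational_factor_shift a b u : 0 < b ->
  rational_factor a b (shift b u) = a%:K *: A u.
Proof.
move=> b0; rewrite scale_lfunE comp_lfunE -(comp_lfunE A) -shift_comm.
by rewrite comp_lfunE lker0_lfunK // lker0_shift.
Qed.

(** For u = (b I + A) p and v = (b I + A) q, both sides equal a (b (Ap, q) + (Ap, Aq)). *)
Lemma rational_factor_self_adjoint a b : 0 < b ->
  self_adjoint dot (rational_factor a b).
Proof.
move=> b0 u v; have K := lker0_lfunVK (lker0_shift b0).
rewrite -[u]K -[v]K !rational_factor_shift // !shiftE.
rewrite !dot_realZl dot_realZr !dotDl !dotDr dot_realZl dot_realZr.
by rewrite A_sa.
Qed.

(** For u = (b I + A) p, the form is a (b (Ap, p) + |Ap|^2), and p is nonzero because u is. *)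
Lemma rational_factor_pos a b : 0 < a -> 0 < b ->
  op_pos dot (rational_factor a b).
Proof.
move=> a0 b0 u; have K := lker0_lfunVK (lker0_shift b0).
rewrite -[u]K; set p := (_^-1)%VF u => p0.
have {}p0 : p != 0 by apply: contraNneq p0 => ->; rewrite linear0.
rewrite rational_factor_shift // shiftE dot_realZl dotDr dot_realZr.
rewrite mulr_gt0 ?real_scalar_gt0 // ltr_pwDl ?dot_self_ge0 //.
by rewrite mulr_gt0 ?real_scalar_gt0 ?A_pos.
Qed.

Lemma rational_factor_comm a b a' b' : 0 < b -> 0 < b' ->
  (rational_factor a b \o rational_factor a' b' =
   rational_factor a' b' \o rational_factor a b)%VF.
Proof.
move=> b0 b'0; have S := comp_inv_lfun_comm (lker0_shift _) (shift_comm _).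
(* The shifts commute, and passing to the inverse on one side at a time preserves this. Both
   products then reduce to a a' times the two inverses applied to A A u. *)
have SS : ((shift b)^-1 \o (shift b')^-1 = (shift b')^-1 \o (shift b)^-1)%VF.
  apply/comp_inv_lfun_comm; first exact: lker0_shift.
  apply/esym/comp_inv_lfun_comm; first exact: lker0_shift.
  exact: shift_comm_shift.
apply/lfunP => u; rewrite !comp_lfunE !scale_lfunE !comp_lfunE !linearZ /=.
rewrite !scalerA mulrC; congr (_ *: _).
rewrite -[A ((shift b')^-1%VF _)]comp_lfunE -S // comp_lfunE.
rewrite -[A ((shift b)^-1%VF _)]comp_lfunE -S // comp_lfunE.
by rewrite -[LHS]comp_lfunE SS comp_lfunE.
Qed.

End RationalFactor.

(** * Energy estimate, stability and solvability of the scheme *)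

Section Scheme.
Context (R : realType) (s : scalars) (H : vectType (scalar_field R s)).
Context (dot : {dot H for conj_scalar R s}).

(* Testing the substep with z = sigma y + (1 - sigma) x gives
   |y|^2 - |x|^2 + (2 sigma - 1) |y - x|^2 = - 2 tau (P z, z), whose right-hand
   side is real because P is self-adjoint. *)
Lemma weighted_step_contraction (P : 'End(H)) (sigma tau : R) (x y : H) :
  self_adjoint dot P -> op_pos dot P -> 1 / 2 <= sigma -> 0 < tau ->
  (tau^-1)%:K *: (y - x) + P (sigma%:K *: y + (1 - sigma)%:K *: x) = 0 ->
  dot y y <= dot x x.
Proof.
move=> P_sa P_pos hsigma tau0; set z := _ + _ *: x => step.
have dE : y - x = - (tau%:K *: P z).
  have /(congr1 (fun v => tau%:K *: v)) := step.
  rewrite scaler0 scalerDr scalerA -rmorphM divff ?gt_eqF // rmorph1 scale1r.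
  by move/eqP; rewrite addr_eq0 => /eqP.
have energy : dot y y - dot x x =
    - (2 * (tau%:K * dot (P z) z) + (2 * sigma - 1)%:K * dot (y - x) (y - x)).
  have dz : dot (y - x) z = - (tau%:K * dot (P z) z).
    by rewrite dE dotNl dot_realZl.
  have zd : dot z (y - x) = - (tau%:K * dot (P z) z).
    by rewrite dE dotNr dot_realZr P_sa.
  (* Splitting symmetrically over the two orders of the arguments makes the cross terms cancel
     without commuting [dot x y] and [dot y x], so [ring] works over both fields. *)
  have -> : 2 * (tau%:K * dot (P z) z) = - (dot (y - x) z + dot z (y - x)).
    by rewrite dz zd; ring.
  rewrite /z !(dotDl, dotDr, dotNl, dotNr, dot_realZl, dot_realZr).
  rewrite !rmorphB rmorphM rmorph1 rmorph_nat /=; ring.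
rewrite -subr_le0 energy oppr_le0 addr_ge0 // mulr_ge0 ?dot_self_ge0 //.
  by rewrite mulr_ge0 ?real_scalar_ge0 ?op_pos_ge0 // ltW.
by rewrite real_scalar_ge0 // subr_ge0 mulrC -ler_pdivrMr.
Qed.

Context (m : nat) (D : 'I_m -> 'End(H)) (sigma : R).

Lemma solves_scheme_sub (tau : R) (N : nat) (u0 v0 : H) (w v : nat -> H) :
  solves_scheme D sigma tau N u0 w -> solves_scheme D sigma tau N v0 v ->
  solves_scheme D sigma tau N (u0 - v0) (fun k => w k - v k).
Proof.
move=> [w0 hw] [vE hv]; split=> [|n i nN]; first by rewrite w0 vE.
have := congr2 (fun p q => p - q) (hw n i nN) (hv n i nN).
rewrite subrr => <-; rewrite [X in _ = _ + X]opprD [RHS]addrACA -scalerBr -linearB /=.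
congr (_ *: _ + D i _); first by rewrite !opprD addrACA.
by rewrite !scalerBr opprD addrACA.
Qed.

Hypothesis hm : (0 < m)%N.
Hypothesis D_sa : forall i, self_adjoint dot (D i).
Hypothesis D_pos : forall i, op_pos dot (D i).
Hypothesis hsigma : 1 / 2 <= sigma.

Lemma solves_scheme_contraction (tau : R) (N : nat) (u0 : H) (w : nat -> H) :
  0 < tau -> solves_scheme D sigma tau N u0 w ->
  forall k, (k <= N * m)%N -> dot (w k) (w k) <= dot u0 u0.
Proof.
move=> tau0 [<- hw]; elim=> [//|k IHk] kN.
apply: le_trans (IHk (ltnW kN)).
(* The passage from level k to k + 1 is the substep with ordinal [k %% m] of time step [k %/ m]. *)
have nN : (k %/ m < N)%N by rewrite ltn_divLR.
have := hw _ (Ordinal (ltn_pmod k hm)) nN.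
rewrite /= addnS -divn_eq; exact: weighted_step_contraction.
Qed.

Lemma solves_scheme_hnorm (tau : R) (N : nat) (u0 : H) (w : nat -> H) :
  0 < tau -> solves_scheme D sigma tau N u0 w ->
  forall k, (k <= N * m)%N -> hnorm dot (w k) <= hnorm dot u0.
Proof.
move=> tau0 hw k kN; apply/ler_wsqrtr/re_scalar_le.
exact: solves_scheme_contraction hw k kN.
Qed.

Lemma scheme_stable : unconditionally_stable dot D sigma.
Proof.
exists 1 => // tau N u0 v0 w v tau0 _ hw hv n nN; rewrite mul1r.
apply: (solves_scheme_hnorm tau0 (solves_scheme_sub hw hv)).
by rewrite leq_mul2r nN orbT.
Qed.

Lemma scheme_unique (tau : R) (N : nat) (u0 : H) (w v : nat -> H) :
  0 < tau -> solves_scheme D sigma tau N u0 w ->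
  solves_scheme D sigma tau N u0 v ->
  forall k, (k <= N * m)%N -> w k = v k.
Proof.
move=> tau0 hw hv k kN; apply/eqP; rewrite -subr_eq0.
apply/negPn/negP => /(dot_self_gt0 dot)/lt_geF.
have := solves_scheme_contraction tau0 (solves_scheme_sub hw hv) kN.
by rewrite subrr linear0l => ->.
Qed.

(** A substep from x to y reads (I / tau + sigma D_i) y = x / tau - (1 - sigma) D_i x, and the
    operator on the left is positive, hence invertible. *)
Lemma scheme_exists (tau : R) (N : nat) (u0 : H) : 0 < tau ->
  exists w, solves_scheme D sigma tau N u0 w.
Proof.
move=> tau0.
have sigma0 : 0 <= sigma by apply: le_trans hsigma; rewrite divr_ge0.
pose L i : 'End(H) := ((tau^-1)%:K *: \1 + sigma%:K *: D i)%VF.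
have L0 i : lker (L i) == 0%VS.
  by apply/(@op_pos_lker0 _ _ _ dot)/op_pos_shift; rewrite ?invr_gt0.
pose next i x := (L i)^-1%VF ((tau^-1)%:K *: x - (1 - sigma)%:K *: D i x).
(* A single recursion over all levels cycles through the operators by taking the index [k %% m]. *)
pose w := nat_rect (fun=> H) u0 (fun k x => next (Ordinal (ltn_pmod k hm)) x).
exists w; split=> // n i nN; rewrite addnS /=.
have -> : Ordinal (ltn_pmod (n * m + i) hm) = i.
  by apply: val_inj; rewrite /= modnMDl modn_small.
set x := w _; have : L i (next i x) = _ := lker0_lfunVK (L0 i) _.
rewrite !lfunE /= !lfunE /= !lfunE /= => E.
rewrite [D i _]linearD !linearZ /= scalerBr addrACA E.
by rewrite addrACA subrr addNr addr0.
Qed.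

End Scheme.

Theorem theorem1 (R : realType) (s : scalars)
    (H : vectType (scalar_field R s)) (dot : {dot H for conj_scalar R s})
    (A : 'End(H)) (delta : R) (hdelta : 0 < delta)
    (A_sa : self_adjoint dot A) (A_ge : op_ge dot A (delta%:K *: \1%VF))
    (alpha beta : R) (halpha : 0 < alpha < 1) (hbeta : beta = 1 - alpha)
    (m : nat) (hm : (1 <= m)%N) (a b : 'I_m -> R -> R)
    (ha : forall i, 0 < a i beta) (hb : forall i, 0 < b i beta)
    (Di : 'I_m -> 'End(H))
    (hDi : forall i,
       Di i = (a i beta)%:K *: ((((b i beta)%:K *: \1 + A)^-1) \o A)%VF)
    (D : 'End(H)) (hD : D = \sum_(i < m) Di i) :
  [/\ forall i, self_adjoint dot (Di i) /\ op_pos dot (Di i),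
      forall i j, (Di i \o Di j)%VF = (Di j \o Di i)%VF &
      forall sigma : R, 1 / 2 <= sigma ->
        unconditionally_stable dot Di sigma /\
        forall (T : R) (N : nat) (u0 : H), 0 < T -> (1 <= N)%N ->
          uniquely_solvable Di sigma (T / N%:R) N u0 /\
          forall w : nat -> H, solves_scheme Di sigma (T / N%:R) N u0 w ->
            forall n : nat, (n < N)%N ->
              hnorm dot (w (n.+1 * m)%N) <= hnorm dot u0].
Proof.
have A_pos := op_ge_pos hdelta A_ge.
have Di_sa i : self_adjoint dot (Di i).
  by rewrite hDi; exact: rational_factor_self_adjoint.
have Di_pos i : op_pos dot (Di i).
  by rewrite hDi; exact: rational_factor_pos.
split=> [//|i j|sigma hsigma].
  by rewrite !hDi; exact: (@rational_factor_comm _ _ _ dot).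
split=> [|T N u0 T0 N0]; first exact: scheme_stable.
have tau0 : 0 < T / N%:R by rewrite divr_gt0 ?ltr0n.
split=> [|w hw n nN]; last first.
  by apply: solves_scheme_hnorm hw _ _ => //; rewrite leq_mul2r nN orbT.
split; first exact: (@scheme_exists _ _ _ dot).
by move=> w v; exact: (@scheme_unique _ _ _ dot).
Qed.
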